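(* Let $m,n\ge 1$ be integers. The multigraph $C_{m\times n}$ supports a nullhomotopic tour if and only if none of the following hold: (i) $m$ and $n$ are both odd and at least one of $m,n$ is greater than $1$; (ii) $m=1$ and $n>1$; (iii) $m=2$; (iv) $m=4$ and $n$ is even.
   Context: A knight pair is an ordered pair of integers $(x,y)$ with $\{|x|,|y|\}=\{1,2\}$. For positive integers $m,n$, the multigraph $C_{m\times n}$ (knight's graph of the $m\times n$ cylinder) has vertex set $\{(a,b)\in\mathbb{Z}^2 : 0\le a\le m-1,\ 0\le b\le n-1\}$. A cylindrical jump is a knight pair $(x,y)$ together with a vertex $(a,b)$ such that $0\le a+x\le m-1$; it joins $(a,b)$ to $(a+x,(b+y)\bmod n)$. The jumps $(x,y),(a,b)$ and $(-x,-y),(a+x,(b+y)\bmod n)$ are declared equivalent, and $C_{m\times n}$ has exactly one edge for each equivalence class of jumps (so parallel edges may occur). Let $C$ be the cylinder obtained from the strip $[0,m]\times\mathbb{R}$ by identifying $(s,u)$ with $(s,u+n)$, with base point $c=(1/2,1/2)$. Define $j_c$ sending vertex $(a,b)$ to $(a+1/2,b+1/2)$ and the edge given by the jump $(x,y),(a,b)$ to the path $t\mapsto (a+1/2+xt,\,(b+1/2+yt)\bmod n)$, $t\in[0,1]$ (well defined up to reversal). A tour on $C_{m\times n}$ is a Hamiltonian cycle based at $(0,0)$: if $mn=1$ it is the constant loop at $(0,0)$; otherwise it is a cyclic sequence $(0,0)=v_0,v_1,\dots,v_{mn-1}$ listing every vertex exactly once, together with pairwise distinct edges $e_0,\dots,e_{mn-1}$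 where $e_i$ joins $v_i$ and $v_{i+1}$ (indices mod $mn$). Traversing $j_c(e_0),\dots,j_c(e_{mn-1})$ in order gives a loop in $C$ based at $c$. The tour is nullhomotopic if this loop represents the identity of $\pi_1(C,c)$. $C_{m\times n}$ supports a nullhomotopic tour if some tour on it is nullhomotopic. *)

(* Defs.v *)
From HB Require Import structures.
From mathcomp Require Import all_boot all_order all_algebra.
From mathcomp Require Import all_classical all_reals topology normedtype.

Set Implicit Arguments.
Unset Strict Implicit.
Unset Printing Implicit Defensive.

Import Order.TTheory GRing.Theory Num.Theory.
Import numFieldNormedType.Exports.

Local Open Scope classical_set_scope.
Local Open Scope ring_scope.
Local Open Scope quotient_scope.

(** * The knight multigraph of the m x n cylinder *)

Definition vertex : Type := (int * int)%type.

Definition is_vertex (m n : nat) (v : vertex) : bool :=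
  (0 <= v.1 <= m%:Z - 1) && (0 <= v.2 <= n%:Z - 1).

Definition knight_pair (p : int * int) : bool :=
  ((`|p.1| == 1) && (`|p.2| == 2)) || ((`|p.1| == 2) && (`|p.2| == 1)).

(* A jump is stored as ((x, y), (a, b)): a knight pair and a starting vertex. *)
Definition jump : Type := ((int * int) * vertex)%type.

Definition is_jump (m n : nat) (j : jump) : bool :=
  [&& knight_pair j.1, is_vertex m n j.2 & 0 <= j.2.1 + j.1.1 <= m%:Z - 1].

Definition jump_source (j : jump) : vertex := j.2.

Definition jump_target (n : nat) (j : jump) : vertex :=
  (j.2.1 + j.1.1, ((j.2.2 + j.1.2) %% n%:Z)%Z).

Definition jump_rev (n : nat) (j : jump) : jump :=
  ((- j.1.1, - j.1.2), jump_target n j).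

(* jump_rev n is an involution on the jumps of C_{m x n}, so the equivalence
   class of a jump j consists of j and jump_rev n j. *)
Definition edge_of (n : nat) (j : jump) : set jump := [set j; jump_rev n j].

Definition is_edge (m n : nat) (E : set jump) : Prop :=
  exists2 j, is_jump m n j & E = edge_of n j.

(* The jump j represents the edge E traversed from v to w. *)
Definition traverses (n : nat) (E : set jump) (v w : vertex) (j : jump) : Prop :=
  [/\ E j, jump_source j = v & jump_target n j = w].

Definition joins (n : nat) (E : set jump) (v w : vertex) : Prop :=
  exists j, traverses n E v w j.

(* The number of edges of a tour: a Hamiltonian cycle on a single vertex is the
   constant loop, without edges. *)
Definition tour_length (m n : nat) : nat :=
  if (m * n == 1)%N then 0%N else (m * n)%N.

(* Only the values v i with i < m * n and E i with i < tour_length m n matter. *)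
Definition is_tour (m n : nat) (v : nat -> vertex) (E : nat -> set jump) :
    Prop :=
  [/\ v 0%N = (0, 0),
      forall i, (i < m * n)%N -> is_vertex m n (v i),
      forall w, is_vertex m n w -> exists! i, (i < m * n)%N /\ v i = w,
      forall i, (i < tour_length m n)%N ->
        is_edge m n (E i) /\ joins n (E i) (v i) (v (i.+1 %% (m * n))%N)
    & forall i k, (i < tour_length m n)%N -> (k < tour_length m n)%N ->
        E i = E k -> i = k].

(** * Paths and homotopies; paths are functions on R, considered on [0, 1] *)

Section Paths.
Context {R : realType} {T : topologicalType}.

Definition path_concat (f g : R -> T) : R -> T :=
  fun t => if t <= 2^-1 then f (2 * t) else g (2 * t - 1).

Definition path_concat_seq (c : T) (s : seq (R -> T)) : R -> T :=
  if s is f :: s' then foldl path_concat f s' else cst c.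

Definition path_homotopic (f g : R -> T) : Prop :=
  exists H : R * R -> T,
    [/\ {within `[0, 1]%classic `*` `[0, 1]%classic, continuous H},
        forall t : R, t \in `[0, 1] -> H (0, t) = f t,
        forall t : R, t \in `[0, 1] -> H (1, t) = g t,
        forall s : R, s \in `[0, 1] -> H (s, 0) = f 0
      & forall s : R, s \in `[0, 1] -> H (s, 1) = f 1].

End Paths.

(** * The topological cylinder *)

Section Cylinder.
Context (R : realType) (m n : nat).

Definition strip_set : set (R * R) := [set p | 0 <= p.1 <= m%:R].

Definition strip : topologicalType := set_type strip_set.

Definition strip_rel (p q : strip) : bool :=
  ((val p).1 == (val q).1) &&
  `[< exists k : int, (val q).2 = (val p).2 + k%:~R * n%:R >].

Lemma strip_rel_refl : reflexive strip_rel.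
Proof.
by move=> p; rewrite /strip_rel eqxx; apply/asboolP; exists 0; rewrite mul0r addr0.
Qed.

Lemma strip_rel_sym : symmetric strip_rel.
Proof.
have sub p q : strip_rel p q -> strip_rel q p.
  case/andP => /eqP e /asboolP [k h]; rewrite /strip_rel e eqxx /=.
  by apply/asboolP; exists (- k); rewrite h mulrNz mulNr addrK.
by move=> p q; apply/idP/idP; exact: sub.
Qed.

Lemma strip_rel_trans : transitive strip_rel.
Proof.
move=> q p r /andP[/eqP e /asboolP [k h]] /andP[/eqP e' /asboolP [l h']].
rewrite /strip_rel e e' eqxx /=; apply/asboolP.
by exists (k + l); rewrite h' h intrD mulrDl addrA.
Qed.

Definition strip_equiv : equiv_rel strip :=
  EquivRel strip_rel strip_rel_refl strip_rel_sym strip_rel_trans.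

Definition cylinder : topologicalType :=
  quotient_topology {eq_quot strip_equiv}.

Lemma strip_set0 : (0, 0) \in strip_set.
Proof. by rewrite inE /strip_set /= lexx ler0n. Qed.

Definition strip_point (p : R * R) : strip :=
  insubd (exist _ (0, 0) strip_set0 : strip) p.

(* Meant for points p of the strip only. *)
Definition cylinder_point (p : R * R) : cylinder :=
  \pi_(quotient_topology {eq_quot strip_equiv}) (strip_point p).

Definition base_point : cylinder := cylinder_point (2^-1, 2^-1).

(* The second coordinate need not be reduced modulo n, since points of the strip
   which differ by (0, n) are identified in the cylinder. *)
Definition jump_path (j : jump) : R -> cylinder := fun t =>
  cylinder_point (j.2.1%:~R + 2^-1 + j.1.1%:~R * t,
                  j.2.2%:~R + 2^-1 + j.1.2%:~R * t).

(* J i is the representative of E i which leaves v i; it is unique, as a jump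
   and its reverse have distinct sources. *)
Definition tour_nullhomotopic (v : nat -> vertex) (E : nat -> set jump) :
    Prop :=
  exists J : nat -> jump,
    (forall i, (i < tour_length m n)%N ->
       traverses n (E i) (v i) (v (i.+1 %% (m * n))%N) (J i)) /\
    path_homotopic
      (path_concat_seq base_point
         [seq jump_path (J i) | i <- iota 0 (tour_length m n)])
      (cst base_point).

Definition supports_nullhomotopic_tour : Prop :=
  exists v E, is_tour m n v E /\ tour_nullhomotopic v E.

End Cylinder.

(* Main.v *)
Require Import Defs.
From mathcomp Require Import all_boot all_order all_algebra.
From mathcomp Require Import all_classical all_reals topology normedtype.
From mathcomp Require Import zify ring lra.

(** A lift of the tour to the universal cover [0,m] x R of the cylinder is a
closed polygon exactly when the jumps of the tour add up to zero, and this is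
equivalent to nullhomotopy: a closed lift is contracted by a straight-line
homotopy, and conversely the winding number read off a fine grid does not change
along a homotopy.

The obstructions are then combinatorial. If m and n are odd, an odd number of
jumps, each with an odd coordinate sum, cannot add up to zero. If m = 2, the
lift runs along a line without cycles. If m = 4 and n is even, the tour
alternates between the outer and the inner columns, hence each of these pairs of
columns is monochromatic for the checkerboard colouring.

For the existence, consider tours which contain all the n edges (_rungs_) that
join (m-2,b) to (m-1,b+2). Replacing each rung p - q by the detour
p, p+(2,1), q+(2,1), q gives a tour with the same property on the cylinder of
width m+2, so the widths 3 (n even), 4 (n odd) and 6 (n even) suffice. In each
of them the lifts for n and n+k differ by the insertion of a fixed pattern on
the way up and of another one on the way down. *)

Set Implicit Arguments.
Unset Strict Implicit.
Unset Printing Implicit Defensive.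

Import Order.TTheory GRing.Theory Num.Theory.
Import numFieldNormedType.Exports.

Local Open Scope classical_set_scope.
Local Open Scope ring_scope.
Local Open Scope quotient_scope.

(** * Homotopies in the cylinder *)

Lemma continuous_pair (T U V : topologicalType) (f : T -> U) (g : T -> V) :
  continuous f -> continuous g -> continuous (fun x => (f x, g x)).
Proof. by move=> cf cg x; apply: cvg_pair; [exact: cf | exact: cg]. Qed.

Section CylinderTopology.
Context (R : realType) (m n : nat).
Local Notation cyl := (cylinder R m n).
Local Notation str := (strip R m).
Local Notation pt := (@cylinder_point R m n).

Lemma val_strip_point (p : R * R) :
  strip_set m p -> val (strip_point m p) = p.
Proof. by move=> sp; rewrite /strip_point val_insubd mem_set. Qed.

Lemma cylinder_piP (p q : str) :
  \pi_cyl p = \pi_cyl q <-> strip_rel n p q.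
Proof.
split; first by move=> h; apply/(@eqmodP _ (strip_equiv R m n)).
by move/(@eqmodP _ (strip_equiv R m n)).
Qed.

Lemma cylinder_point_translate (p : R * R) (k : int) :
  pt (p.1, p.2 + k%:~R * n%:R) = pt p.
Proof.
rewrite /cylinder_point.
have sE : (p.1, p.2 + k%:~R * n%:R) \in strip_set m = (p \in strip_set m).
  by apply/idP/idP; rewrite !inE.
case: (boolP (p \in strip_set m)) => sp.
  apply/esym/cylinder_piP; rewrite /strip_rel.
  have {}sp : strip_set m p by exact: set_mem sp.
  rewrite !val_strip_point //.
  by rewrite eqxx /=; apply/asboolP; exists k.
(* Off the strip, [strip_point] sends both points to its default value [(0, 0)]. *)
by congr (\pi _); apply: val_inj; rewrite /strip_point /insubd !insubN ?sE.
Qed.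

(* Composing with this retraction onto the strip gives globally continuous maps
   into the cylinder, so that no subspace topology is needed below. *)
Definition strip_clamp (p : R * R) : R * R :=
  (Num.max 0 (Num.min m%:R p.1), p.2).

Lemma strip_clampP p : strip_set m (strip_clamp p).
Proof.
by rewrite /strip_set/= le_max lexx /= ge_max ler0n ge_min lexx.
Qed.

Lemma strip_clamp_id p : strip_set m p -> strip_clamp p = p.
Proof.
case: p => x y /= /andP[/= x0 xm].
by rewrite /strip_clamp/= min_r // max_r.
Qed.

Lemma clamped_point_continuous : continuous (pt \o strip_clamp).
Proof.
have cs : continuous (strip_point m \o strip_clamp : _ -> str).
  apply: continuous_comp_initial.
  rewrite (_ : _ \o _ = strip_clamp); last first.
    by apply/funext => p /=; apply: val_strip_point; exact: strip_clampP.
  apply: (@continuous_pair (R * R)%type R R (fun p => (strip_clamp p).1) snd).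
    move=> p.
  apply: (@continuous_max R _ (cst 0) (fun p : R * R => Num.min m%:R p.1)).
    exact: cst_continuous.
  apply: (@continuous_min R _ (cst m%:R) (fun p : R * R => p.1)).
    exact: cst_continuous.
  exact: cvg_fst.
  move=> p; exact: cvg_snd.
move=> p; apply: (continuous_comp (cs p)); exact: pi_continuous.
Qed.

(** Only heights are compared, modulo [n], since the winding around the cylinder is all that will be
    measured. *)
Definition close_points (e : R) (c c' : cyl) : Prop :=
  exists p q : str, [/\ \pi_cyl p = c, \pi_cyl q = c' & `|(val q).2 - (val p).2| < e].

(** The preimage in the strip is the union of the open horizontal bands around the translates by
    [k * n] of one representative of [c]. *)
Lemma open_close_points e c : open (close_points e c).
Proof.
rewrite /open /= /quotient_open.
rewrite (_ : _ @^-1` _ = \bigcup_(k : int)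
   ((fun q : str => (val q).2) @^-1` (ball ((val (repr c)).2 + k%:~R * n%:R) e))); last first.
  apply/seteqP; split => q /=.
    move=> [p [q' [pc /cylinder_piP/andP[_ /asboolP[k hk]] h]]].
    have : \pi_cyl p = \pi_cyl (repr c) by rewrite pc reprK.
    move/cylinder_piP => /andP[_ /asboolP[l hl]].
    exists (k - l) => //=; rewrite /ball/= hk hl intrD mulrNz.
    apply: le_lt_trans h; rewrite distrC le_eqVlt; apply/orP; left; apply/eqP.
    by congr (`|_|); ring.
  move=> [k _ /=]; rewrite /ball /= => h.
  exists (strip_point m ((val (repr c)).1, (val (repr c)).2 + k%:~R * n%:R)), q.
  split => //.
    transitivity (pt (val (repr c))); first exact: cylinder_point_translate.
    by rewrite /cylinder_point /strip_point valKd reprK.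
  rewrite val_strip_point /= 1?distrC //.
  by have /set_mem := valP (repr c).
apply: bigcup_open => k _.
apply: open_comp; last exact: ball_open.
have cval : continuous (set_val : str -> R * R) by exact: initial_continuous.
move=> q _; apply: (continuous_comp (cval q)); exact: cvg_snd.
Qed.
End CylinderTopology.

(** Compactness is applied to the filter of radii decreasing to 0; half of the local radius at [x]
    leaves room for the triangle inequality. *)
Lemma lebesgue_number (R : realType) (X : pseudoMetricType R) (K : set X)
    (P : X -> X -> Prop) : compact K ->
  (forall x, K x -> exists2 d : R, 0 < d &
    forall z z', K z -> K z' -> ball x d z -> ball x d z' -> P z z') ->
  exists2 d : R, 0 < d & forall z z', K z -> K z' -> ball z d z' -> P z z'.
Proof.
move=> /compact_near_coveringP cK hP.
have := cK R 0^'+ (fun d z => K z -> forall z', K z' -> ball z d z' -> P z z').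
case.
  move=> x /hP[d d0 hd].
  exists (ball x (d / 2), [set r | r < d / 2]).
    split; first by apply: nbhsx_ballx; rewrite divr_gt0.
    by apply: nbhs_right_lt; rewrite divr_gt0.
  move=> [z r] /= [xz rd] sz z' sz' zz'.
  have d2 : d / 2 <= d by lra.
  apply: hd => //; first exact: le_ball xz.
  rewrite (splitr d); apply: ball_triangle xz _; apply: le_ball zz'; exact: ltW.
move=> e /= e0 he; exists (e / 2); first by rewrite divr_gt0.
move=> z z' Kz; apply: (he (e / 2)) => //=; last by rewrite divr_gt0.
by rewrite sub0r normrN gtr0_norm ?divr_gt0 //; lra.
Qed.

(** * Winding numbers of loops in the cylinder *)

Section Homotopy.
Context (R : realType) (m n : nat).
Hypothesis n_gt0 : (0 < n)%N.
Local Notation cyl := (cylinder R m n).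
Local Notation str := (strip R m).
Local Notation pt := (@cylinder_point R m n).
Local Notation square := (`[0, 1]%classic `*` `[0, 1]%classic : set (R * R)).

Lemma close_points_sym e (c c' : cyl) : close_points e c c' -> close_points e c' c.
Proof. by case=> p [q [pc qc h]]; exists q, p; rewrite distrC. Qed.

(** [repr] picks an arbitrary representative, so this number has a meaning only modulo [n]. *)
Definition height (c : cyl) : R := (val (repr c)).2.

Lemma close_pointsP e (c c' : cyl) : close_points e c c' ->
  exists2 y : R, `|y| < e & exists k : int, y = height c' - height c + k%:~R * n%:R.
Proof.
case=> p [q [pc qc h]]; exists ((val q).2 - (val p).2) => //.
have : \pi_cyl p = \pi_cyl (repr c) by rewrite pc reprK.
have : \pi_cyl q = \pi_cyl (repr c') by rewrite qc reprK.
move=> /cylinder_piP /andP[_ /asboolP[l hl]] /cylinder_piP /andP[_ /asboolP[k hk]].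
exists (k - l); rewrite /height hl hk intrD mulrNz; ring.
Qed.

Lemma close_points_trans e1 e2 (c c' c'' : cyl) :
  close_points e1 c c' -> close_points e2 c' c'' -> close_points (e1 + e2) c c''.
Proof.
case=> p [q [pc qc h]] [p' [q' [pc' qc' h']]].
have /cylinder_piP /andP[/eqP ep /asboolP[k hk]] : \pi_cyl p' = \pi_cyl q.
  by rewrite pc'.
exists p, (strip_point m ((val q').1, (val q').2 + k%:~R * n%:R)); split => //.
  transitivity (pt (val q')); first exact: cylinder_point_translate.
  by rewrite /cylinder_point /strip_point valKd.
rewrite val_strip_point /=; last by have /set_mem := valP q'.
apply: le_lt_trans (ltrD h h'); rewrite hk addrC.
apply: le_trans (ler_normD _ _).
rewrite le_eqVlt; apply/orP; left; apply/eqP; congr (`|_|); ring.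
Qed.

Lemma uniformly_close (H : R * R -> cyl) (e : R) :
  {within square, continuous H} -> 0 < e ->
  exists2 d : R, 0 < d & forall z z', square z -> square z' -> ball z d z' ->
    close_points e (H z) (H z').
Proof.
move=> /subspace_continuousP cH e0; apply: lebesgue_number.
  by apply: compact_setX; exact: segment_compact.
move=> x sx.
have : nbhs (H x) (close_points (e / 2) (H x)).
  apply: open_nbhs_nbhs; split; first exact: open_close_points.
  by exists (repr (H x)), (repr (H x)); rewrite reprK subrr normr0 divr_gt0.
move=> /(cH x sx) /=; rewrite /within /= nbhs_simpl /= => /nbhs_ballP[d /= d0 hd].
exists d => // z z' sz sz' xz xz'.
rewrite (splitr e); apply: (close_points_trans (c' := H x)).
  by apply: close_points_sym; exact: hd.
exact: hd.
Qed.

(* The representative of x modulo n in [-n/2, n/2). *)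
Definition wrap (x : R) : R := x - (Num.floor (x / n%:R + 2^-1))%:~R * n%:R.

Lemma wrapP (x y : R) (k : int) :
  `|y| < n%:R / 2 -> y = x + k%:~R * n%:R -> wrap x = y.
Proof.
move=> hy yE.
have n0 : 0 < n%:R :> R by rewrite ltr0n.
rewrite /wrap (_ : Num.floor _ = - k); first by rewrite yE mulrNz mulNr opprK.
apply: floor_def.
have -> : x / n%:R + 2^-1 = y / n%:R + 2^-1 - k%:~R.
  by rewrite yE mulrDl mulfK ?gt_eqF //; ring.
move: hy; rewrite ltr_norml => /andP[h1 h2].
have h3 : - 2^-1 < y / n%:R by rewrite ltr_pdivlMr // mulrC mulrN.
have h4 : y / n%:R < 2^-1 by rewrite ltr_pdivrMr // mulrC.
rewrite intrD mulrNz; lra.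
Qed.

(** The signed height change from [c] to [c'] along the shorter way around the cylinder. *)
Definition wdiff (c c' : cyl) : R := wrap (height c' - height c).

Lemma wdiffxx c : wdiff c c = 0.
Proof.
by apply: (@wrapP _ _ 0); rewrite ?normr0 ?subrr ?mul0r ?addr0 ?divr_gt0 ?ltr0n.
Qed.

(** Two changes below [n / 4] add up to one below [n / 2], which [wrap] recovers exactly. *)
Lemma wdiffD (a b c : cyl) : close_points (n%:R / 4) a b ->
  close_points (n%:R / 4) b c -> wdiff a b + wdiff b c = wdiff a c.
Proof.
move=> /close_pointsP[y hy [k yE]] /close_pointsP[z hz [l zE]].
have n0 : 0 < n%:R :> R by rewrite ltr0n.
rewrite /wdiff (wrapP _ yE) ?(wrapP _ zE); [|lra..].
apply/esym/(@wrapP _ _ (k + l)).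
  by apply: le_lt_trans (ler_normD _ _) _; lra.
rewrite yE zE intrD; ring.
Qed.

Lemma wdiff_pt (p q : R * R) : strip_set m p -> strip_set m q ->
  `|q.2 - p.2| < n%:R / 2 -> wdiff (pt p) (pt q) = q.2 - p.2.
Proof.
move=> sp sq h.
have hE r : strip_set m r -> exists k : int, height (pt r) = r.2 + k%:~R * n%:R.
  move=> sr.
  have : \pi_cyl (repr (pt r)) = \pi_cyl (strip_point m r) by rewrite reprK.
  move=> /esym/cylinder_piP /andP[_ /asboolP[k hk]].
  by exists k; rewrite /height hk val_strip_point.
have [k hp] := hE _ sp; have [l hq] := hE _ sq.
apply: (@wrapP _ _ (k - l)) => //.
rewrite hp hq intrD mulrNz; ring.
Qed.

(** On a fine grid of the square, the sum [W i] of the height changes along row [i] does not depend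
    on [i]. In the first row it is the height difference between the ends of [g]; in the last row,
    where [H] is constant, it is 0. *)
Lemma nullhomotopic_lift_closed (g : R -> R * R) : continuous g ->
  (forall t : R, 0 <= t <= 1 -> strip_set m (g t)) ->
  path_homotopic (pt \o g) (cst (pt (g 0))) -> g 1 = g 0.
Proof.
move=> cg sg [H [cH H0 H1 Hl Hr]].
have i0 : 0 \in `[0 : R, 1] by rewrite in_itv /= lexx ler01.
have i1 : 1 \in `[0 : R, 1] by rewrite in_itv /= lexx ler01.
have n0 : 0 < n%:R :> R by rewrite ltr0n.
have s0 : strip_set m (g 0) by apply: sg; rewrite lexx ler01.
have s1 : strip_set m (g 1) by apply: sg; rewrite lexx ler01.
(* [H] fixes the end point, so [g 0] and [g 1] project to the same point and can differ only in
   height. *)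
have g1E : (g 1).1 = (g 0).1.
  have : pt (g 1) = pt (g 0) by have := Hr _ i1; rewrite H1.
  by move/cylinder_piP => /andP[/eqP]; rewrite !val_strip_point.
suff g2E : (g 1).2 = (g 0).2.
  by move: g1E g2E; case: (g 1) (g 0) => [? ?] [? ?] /= -> ->.
have [d1 d10 h1] := uniformly_close cH (divr_gt0 n0 (ltr0n _ 4)).
(* The lift, too, must move by less than [n / 2] along a grid edge, for [wdiff] to give its true
   height change. *)
have [d2 d20 h2] : exists2 d : R, 0 < d &
    forall t t' : R, 0 <= t <= 1 -> 0 <= t' <= 1 -> ball t d t' ->
      `|(g t').2 - (g t).2| < n%:R / 2.
  have [|d d0 hd] := @lebesgue_number R R `[0, 1]
      (fun t t' => `|(g t').2 - (g t).2| < n%:R / 2) (@segment_compact _ _ _).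
    move=> x _; have : {for x, continuous (snd \o g)}.
      by apply: (continuous_comp (cg x)); exact: cvg_snd.
    move=> /cvgr_dist_lt /(_ (n%:R / 4)).
    rewrite divr_gt0 ?ltr0n // => /(_ isT) /nbhs_ballP[d /= d0 hd].
    exists d => // z z' _ _ /hd /= hz /hd /= hz'.
    move: hz hz'; rewrite !ltr_norml => /andP[? ?] /andP[? ?].
    apply/andP; split; lra.
  by exists d => // t t' ht ht'; apply: hd; rewrite /= in_itv.
pose N := (Num.truncn (Num.max d1^-1 d2^-1)).+1.
have N0 : 0 < N%:R :> R by rewrite ltr0n.
have hN : Num.max d1^-1 d2^-1 < N%:R by exact: truncnS_gt.
move: hN; rewrite gt_max => /andP[hN1 hN2].
have N1 : N%:R^-1 < d1 by rewrite invf_plt.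
have N2 : N%:R^-1 < d2 by rewrite invf_plt.
pose x (i : nat) : R := i%:R / N%:R.
have x0 : x 0%N = 0 by rewrite /x mul0r.
have xN : x N = 1 by rewrite /x divff // gt_eqF.
have xi i : (i <= N)%N -> 0 <= x i <= 1.
  by move=> iN; rewrite divr_ge0 ?ler0n //= ler_pdivrMr // mul1r ler_nat.
have xS i : x i.+1 - x i = N%:R^-1.
  by rewrite /x -mulrBl -natr1 addrAC subrr add0r mul1r.
have bS i d : N%:R^-1 < d -> ball (x i) d (x i.+1).
  by move=> hd; rewrite /ball/= distrC xS gtr0_norm // invr_gt0.
have bb i d : N%:R^-1 < d -> ball (x i) d (x i).
  by move=> hd; apply: ballxx; apply: lt_trans hd; rewrite invr_gt0.
pose W i := \sum_(0 <= j < N) wdiff (H (x i, x j)) (H (x i, x j.+1)).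
have WS i : (i < N)%N -> W i = W i.+1.
  move=> iN; apply/eqP; rewrite -subr_eq0 -sumrB.
  (* [E j] is the change across from row [i] to row [i.+1]; both ways around a grid cell add up to
     the change along its diagonal. *)
  pose E j := wdiff (H (x i, x j)) (H (x i.+1, x j)).
  rewrite (eq_big_nat _ _ (F2 := fun j => - (E j.+1 - E j))); last first.
    move=> j /andP[_ jN].
    have sq a b : (a <= N)%N -> (b <= N)%N -> square (x a, x b).
      by move=> aN bN; split; rewrite /= in_itv /= xi.
    have cl a b a' b' : (a <= N)%N -> (b <= N)%N -> (a' <= N)%N -> (b' <= N)%N ->
        ball (x a) d1 (x a') -> ball (x b) d1 (x b') ->
        close_points (n%:R / 4) (H (x a, x b)) (H (x a', x b')).
      by move=> aN bN aN' bN' ha hb; apply: h1; [exact: sq | exact: sq | split].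
    have [iN' jN'] := (ltnW iN, ltnW jN).
    have e1 : wdiff (H (x i, x j)) (H (x i, x j.+1)) + E j.+1 =
              wdiff (H (x i, x j)) (H (x i.+1, x j.+1)).
      apply: wdiffD.
        exact: (cl _ _ _ _ iN' jN' iN' jN (bb _ _ N1) (bS _ _ N1)).
      exact: (cl _ _ _ _ iN' jN iN jN (bS _ _ N1) (bb _ _ N1)).
    have e2 : E j + wdiff (H (x i.+1, x j)) (H (x i.+1, x j.+1)) =
              wdiff (H (x i, x j)) (H (x i.+1, x j.+1)).
      apply: wdiffD.
        exact: (cl _ _ _ _ iN' jN' iN jN' (bS _ _ N1) (bb _ _ N1)).
      exact: (cl _ _ _ _ iN jN' iN jN (bb _ _ N1) (bS _ _ N1)).
    by move: e1 e2; lra.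
  (* Only the values of [E] at both ends remain, and they vanish because [H] keeps the end points
     fixed. *)
  rewrite sumrN telescope_sumr // /E x0 xN.
  have ii a : (a <= N)%N -> x a \in `[0 : R, 1] by move=> aN; rewrite in_itv /= xi.
  by rewrite !Hl ?Hr ?ii ?wdiffxx ?subrr ?oppr0 // ltnW.
have W0N : W 0%N = W N.
  have : forall i, (i <= N)%N -> W 0%N = W i.
    by elim=> // i IH iN; rewrite (IH (ltnW iN)) WS.
  by apply.
have WN0 : W N = 0.
  rewrite /W big_nat big1 // => j /andP[_ jN].
  by rewrite xN !H1 ?wdiffxx // in_itv /= xi // ltnW.
have : W 0%N = (g 1).2 - (g 0).2.
  rewrite -xN -{1}x0 -(telescope_sumr (fun j => (g (x j)).2)) //.
  apply: eq_big_nat => j /andP[_ jN].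
  have ii a : (a <= N)%N -> x a \in `[0 : R, 1] by move=> aN; rewrite in_itv /= xi.
  have jN' := ltnW jN.
  rewrite x0 !H0 ?ii //; apply: wdiff_pt; [exact: sg (xi _ _)..|].
  by apply: h2; [exact: xi.. | exact: bS].
by rewrite W0N WN0 => /esym/eqP; rewrite subr_eq0 => /eqP.
Qed.

Lemma closed_lift_nullhomotopic (g : R -> R * R) : continuous g ->
  (forall t : R, 0 <= t <= 1 -> strip_set m (g t)) -> g 1 = g 0 ->
  path_homotopic (pt \o g) (cst (pt (g 0))).
Proof.
move=> cg sg g10.
pose G (st : R * R) : R * R :=
  ((1 - st.1) * (g st.2).1 + st.1 * (g 0).1, (1 - st.1) * (g st.2).2 + st.1 * (g 0).2).
have s0 : strip_set m (g 0) by apply: sg; rewrite lexx ler01.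
have Gl t : G (0, t) = g t by rewrite /G /= subr0 !mul1r !mul0r !addr0 -surjective_pairing.
have Ge s t : g t = g 0 -> G (s, t) = g 0.
  by move=> h; rewrite /G /= h -!mulrDl subrK !mul1r -surjective_pairing.
exists (pt \o strip_clamp m \o G); split => /=.
- apply: continuous_subspaceT => z.
  apply: (@continuous_comp _ _ _ G (pt \o strip_clamp m));
    last exact: clamped_point_continuous.
  move: z; have c (pr : R * R -> R) : continuous pr ->
      continuous (fun st : R * R => (1 - st.1) * pr (g st.2) + st.1 * pr (g 0)).
    move=> cpr z; apply: cvgD; apply: cvgM.
    + by apply: cvgB; [exact: cvg_cst | exact: cvg_fst].
    + have c1 : {for z, continuous (g \o snd)}.
        by apply: continuous_comp; [exact: cvg_snd | exact: cg].
      exact: (continuous_comp c1 (cpr _)).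
    + exact: cvg_fst.
    + exact: cvg_cst.
  by apply: continuous_pair; apply: c => z; [exact: cvg_fst | exact: cvg_snd].
- by move=> t; rewrite in_itv /= => /sg st; rewrite Gl strip_clamp_id.
- by move=> t _; rewrite /G /= subrr !mul0r !add0r !mul1r -surjective_pairing strip_clamp_id.
- by move=> s _; rewrite Ge ?strip_clamp_id.
- by move=> s _; rewrite Ge ?g10 ?strip_clamp_id.
Qed.
End Homotopy.

(** * Polygonal paths *)

Section PolygonalPaths.
Context (R : realType) (m n : nat).
Hypothesis n_gt0 : (0 < n)%N.
Local Notation pt := (@cylinder_point R m n).

Definition center (p : int * int) : R * R := (p.1%:~R + 2^-1, p.2%:~R + 2^-1).

Definition segment_path (p q : int * int) : R -> R * R := fun t =>
  (p.1%:~R + 2^-1 + (q.1 - p.1)%:~R * t, p.2%:~R + 2^-1 + (q.2 - p.2)%:~R * t).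

(** The same concatenation as for the loop of a tour, so that the projection of the polygon is that
    loop with the same parametrization. *)
Definition polygon (L : nat -> int * int) (N : nat) : R -> R * R :=
  path_concat_seq (center (L 0%N)) [seq segment_path (L i) (L i.+1) | i <- iota 0 N].

Lemma path_concat_seq_rcons (T : topologicalType) (c : T) (s : seq (R -> T)) g :
  path_concat_seq c (rcons s g) =
  if nilp s then g else path_concat (path_concat_seq c s) g.
Proof. by case: s => [|f s] //=; rewrite foldl_rcons. Qed.

Lemma path_concat_seq_comp (T U : topologicalType) (h : T -> U) c (s : seq (R -> T)) :
  path_concat_seq (h c) [seq h \o f | f <- s] = h \o path_concat_seq c s.
Proof.
elim/last_ind: s => [|s g IH] //=.
rewrite map_rcons !path_concat_seq_rcons IH.
have -> : nilp [seq h \o f | f <- s] = nilp s by case: s {IH}.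
case: ifP => // _; apply/funext => t; rewrite /path_concat /=.
by case: ifP.
Qed.

Lemma path_concat_continuous (T : topologicalType) (f g : R -> T) :
  continuous f -> continuous g -> f 1 = g 0 -> continuous (path_concat f g).
Proof.
move=> cf cg fg.
have cf2 : continuous (fun t : R => f (2 * t)).
  move=> t; apply: (@continuous_comp _ _ _ (fun t : R => 2 * t) f); last exact: cf.
  by apply: cvgM; [exact: cvg_cst | exact: cvg_id].
have cg2 : continuous (fun t : R => g (2 * t - 1)).
  move=> t; apply: (@continuous_comp _ _ _ (fun t : R => 2 * t - 1) g); last exact: cg.
  apply: cvgB; last exact: cvg_cst.
  by apply: cvgM; [exact: cvg_cst | exact: cvg_id].
have within_eq (A : set R) (h k : R -> T) : {in A, h =1 k} -> continuous h ->
    {within A, continuous k}.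
  move=> hk ch; apply: (@subspace_eq_continuous _ A T h); first exact: hk.
  exact: continuous_subspaceT.
apply/continuous_subspace_setT.
have -> : [set: R] = [set t | t <= 2^-1] `|` [set t | 2^-1 <= t].
  by apply/seteqP; split => t //= _; case: (leP t 2^-1) => h; [left | right; exact: ltW].
apply: withinU_continuous; [exact: closed_le | exact: closed_ge | |].
- apply: within_eq cf2.
  by move=> t; rewrite inE /path_concat /= => ->.
- apply: within_eq cg2.
  move=> t; rewrite inE /path_concat /= => h; case: ifP => // h'.
  have -> : t = 2^-1 by apply/eqP; rewrite eq_le h h'.
  by rewrite divff ?subrr ?fg // pnatr_eq0.
Qed.

Lemma path_concat0 (T : topologicalType) (f g : R -> T) : path_concat f g 0 = f 0.
Proof. by rewrite /path_concat invr_ge0 ler0n mulr0. Qed.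

Lemma path_concat1 (T : topologicalType) (f g : R -> T) : path_concat f g 1 = g 1.
Proof.
rewrite /path_concat; have -> : (1 <= 2^-1 :> R) = false.
  by apply/negbTE; rewrite -ltNge; lra.
by congr g; lra.
Qed.

Lemma segment_path0 p q : segment_path p q 0 = center p.
Proof. by rewrite /segment_path !mulr0 !addr0. Qed.

Lemma segment_path1 p q : segment_path p q 1 = center q.
Proof. by rewrite /segment_path /center !mulr1 !intrB; congr pair; ring. Qed.

Lemma segment_path_continuous p q : continuous (segment_path p q).
Proof.
apply: continuous_pair => t; (apply: cvgD; first exact: cvg_cst);
  by apply: cvgM; [exact: cvg_cst | exact: cvg_id].
Qed.

Lemma polygonS L N : polygon L N.+1 =
  if N == 0%N then segment_path (L 0%N) (L 1%N)
  else path_concat (polygon L N) (segment_path (L N) (L N.+1)).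
Proof.
rewrite /polygon -addn1 iotaD map_cat /= cats1 path_concat_seq_rcons add0n.
rewrite /nilp size_map size_iota addn1.
by case: eqP => // ->.
Qed.

Lemma polygon_ends L N :
  polygon L N 0 = center (L 0%N) /\ polygon L N 1 = center (L N).
Proof.
elim: N => // N [IH0 IH1]; rewrite polygonS; case: eqP => [->|_].
  by rewrite segment_path0 segment_path1.
by rewrite path_concat0 path_concat1 segment_path1.
Qed.

Lemma polygon_continuous L N : continuous (polygon L N).
Proof.
elim: N => [|N IH]; first by move=> x; exact: cst_continuous.
rewrite polygonS; case: eqP => [_|_]; first exact: segment_path_continuous.
apply: path_concat_continuous => //; first exact: segment_path_continuous.
by rewrite segment_path0; case: (polygon_ends L N).
Qed.

(** The corners are centers of cells of the strip, and the strip is convex. *)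
Lemma polygon_in_strip (L : nat -> int * int) N :
  (forall i, (i <= N)%N -> 0 <= (L i).1 <= m%:Z - 1) ->
  forall t : R, 0 <= t <= 1 -> strip_set m (polygon L N t).
Proof.
have sstrip (p q : int * int) : 0 <= p.1 <= m%:Z - 1 -> 0 <= q.1 <= m%:Z - 1 ->
    forall t : R, 0 <= t <= 1 -> strip_set m (segment_path p q t).
  have toR (z : int) : 0 <= z <= m%:Z - 1 -> 0 <= (z%:~R : R) <= m%:R - 1.
    move=> /andP[z0 zm]; rewrite ler0z z0 /=.
    have : z + 1 <= m%:Z by lia.
    by rewrite -(ler_int R) intrD; lra.
  move=> /toR/andP[p0 pm] /toR/andP[q0 qm] t /andP[t0 t1].
  rewrite /strip_set /= intrB; apply/andP; split; nra.
elim: N => [|N IH] hL t ht.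
  rewrite /polygon /= -(segment_path0 (L 0%N) (L 0%N)).
  by apply: sstrip; rewrite ?hL // lexx ler01.
rewrite polygonS; case: eqP => [N0|_].
  by apply: sstrip => //; apply: hL; rewrite // N0.
move: ht => /andP[t0 t1]; rewrite /path_concat; case: leP => h.
  by apply: IH => [i iN|]; [apply: hL; lia | lra].
by apply: sstrip; [apply: hL; lia.. | lra].
Qed.

(** The jump starts at a height reduced modulo [n], the lifted segment [k * n] above it; this shift
    does not change the projection. *)
Lemma jump_path_segment (j : jump) (p q : int * int) (k : int) :
  j.1 = (q.1 - p.1, q.2 - p.2) -> j.2.1 = p.1 -> p.2 = j.2.2 + k * n%:Z ->
  @jump_path R m n j = pt \o segment_path p q.
Proof.
case: j => [[x y] [a b]] /= [-> ->] -> hk; apply/funext => t.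
rewrite /jump_path /segment_path /= -[LHS](cylinder_point_translate _ _ _ k) /=.
congr (pt (_, _)); rewrite hk !(intrD, intrM, intrB) -!pmulrn; ring.
Qed.

(** [L] lists the corners of the lift of the loop, so nullhomotopy becomes a condition on integer
    points. The obstructions and the constructions both rest on this. *)
Lemma jumps_nullhomotopic (J : nat -> jump) (L : nat -> int * int) (N : nat) :
  L 0%N = (0, 0) ->
  (forall i, (i <= N)%N -> 0 <= (L i).1 <= m%:Z - 1) ->
  (forall i, (i < N)%N ->
    [/\ (J i).1 = ((L i.+1).1 - (L i).1, (L i.+1).2 - (L i).2),
        (J i).2.1 = (L i).1 & exists k : int, (L i).2 = (J i).2.2 + k * n%:Z]) ->
  path_homotopic
    (path_concat_seq (@base_point R m n) [seq @jump_path R m n (J i) | i <- iota 0 N])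
    (cst (@base_point R m n)) <-> L N = (0, 0).
Proof.
move=> L0 Lm hJ.
have -> : [seq @jump_path R m n (J i) | i <- iota 0 N] =
    [seq pt \o f | f <- [seq segment_path (L i) (L i.+1) | i <- iota 0 N]].
  rewrite -map_comp; apply/eq_in_map => i; rewrite mem_iota => /hJ[h1 h2 [k hk]].
  exact: jump_path_segment hk.
have bE : @base_point R m n = pt (center (L 0%N)) by rewrite L0 /center /= add0r.
rewrite bE path_concat_seq_comp -/(polygon L N).
have [P0 P1] := polygon_ends L N.
have cP : continuous (polygon L N) by exact: polygon_continuous.
rewrite -{1}P0; split.
  move=> /(nullhomotopic_lift_closed n_gt0 cP (polygon_in_strip Lm)).
  rewrite P0 P1 L0.
  case: (L N) => a b [/addIr/eqP + /addIr/eqP].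
  by rewrite !eqr_int => /eqP -> /eqP ->.
move=> LN; apply: closed_lift_nullhomotopic cP (polygon_in_strip Lm) _.
by rewrite P0 P1 LN L0.
Qed.
End PolygonalPaths.

(** * Obstructions *)

Lemma knight_pairP p : knight_pair p ->
  (p.1 = 1 \/ p.1 = -1) /\ (p.2 = 2 \/ p.2 = -2) \/
  (p.1 = 2 \/ p.1 = -2) /\ (p.2 = 1 \/ p.2 = -1).
Proof. by rewrite /knight_pair; case: p => x y /=; lia. Qed.

(** The coordinates of a knight pair have an odd sum, and reduction modulo an even [n] keeps parity.
    So the checkerboard colouring is well defined on the cylinder and each jump changes the
    colour. *)
Lemma jump_parity (n : nat) (j : jump) : ~~ odd n -> knight_pair j.1 ->
  odd (absz (j.2.1 + j.1.1 + modz (j.2.2 + j.1.2) n%:Z)) =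
  ~~ odd (absz (j.2.1 + j.2.2)).
Proof.
case: j => [[x y] [a b]] /= nev /knight_pairP /= hk.
have [l hl] : exists l, x + y = l * 2 + 1.
  by case: hk => [[[->|->] [->|->]]|[[->|->] [->|->]]];
    [exists 1 | exists (-1) | exists 0 | exists (-2) |
     exists 1 | exists 0 | exists (-1) | exists (-2)].
have := divz_eq (b + y) n%:Z.
set r := modz _ _; set q := divz _ _.
have -> : n = (n./2 * 2)%N by lia.
rewrite PoszM mulrA; move: (q * _) hl => t; move: r => r; clear; lia.
Qed.

Section Jumps.
Context (m n : nat).
Hypothesis n_gt0 : (0 < n)%N.

Lemma jump_target_vertex j : is_jump m n j -> is_vertex m n (jump_target n j).
Proof.
case: j => [[x y] [a b]] /and3P[_ _ /= ha].
rewrite /is_vertex /= ha modz_ge0 ?gt_eqF //=.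
by have := ltz_pmod (b + y) (n_gt0 : (0 < n%:Z)%R); lia.
Qed.

Lemma jump_rev_is_jump j : is_jump m n j -> is_jump m n (jump_rev n j).
Proof.
move=> jj; have := jump_target_vertex jj.
case: j jj => [[x y] [a b]] /and3P[/= hk hv ha] ht.
apply/and3P; split => //=; first by rewrite /knight_pair /= !normrN.
by move: hv; rewrite /is_vertex /= addrK => /andP[].
Qed.

Lemma jump_revK j : is_jump m n j -> jump_rev n (jump_rev n j) = j.
Proof.
case: j => [[x y] [a b]] /and3P[_ /andP[_ /= hb] _].
rewrite /jump_rev /jump_target /= !opprK addrK modzDml addrK.
by rewrite modz_small //; lia.
Qed.

Lemma edge_of_rev j : is_jump m n j -> edge_of n (jump_rev n j) = edge_of n j.
Proof. by move=> jj; rewrite /edge_of jump_revK // setUC. Qed.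

Lemma traverses_edge E v w j : is_edge m n E -> traverses n E v w j ->
  [/\ is_jump m n j, E = edge_of n j, j.2 = v & jump_target n j = w].
Proof.
move=> [j0 j0j ->] [ej sj tj].
have : j = j0 \/ j = jump_rev n j0 by [].
case=> je; split => //; rewrite je ?edge_of_rev //; exact: jump_rev_is_jump.
Qed.

End Jumps.

Section Necessity.
Context (R : realType) (m n : nat) (v : nat -> vertex) (E : nat -> set jump).
Hypothesis (n_gt0 : (0 < n)%N) (mn_gt1 : (1 < m * n)%N) (vE : is_tour m n v E).

Lemma tour_lengthE : tour_length m n = (m * n)%N.
Proof. by rewrite /tour_length gtn_eqF. Qed.

Lemma tour_jumps (J : nat -> jump) :
  (forall i, (i < tour_length m n)%N ->
     traverses n (E i) (v i) (v (i.+1 %% (m * n))%N) (J i)) ->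
  forall i, (i < m * n)%N ->
    [/\ is_jump m n (J i), E i = edge_of n (J i), (J i).2 = v i &
        jump_target n (J i) = v (i.+1 %% (m * n))%N].
Proof.
case: vE => _ _ _ he _; rewrite tour_lengthE in he * => hJ i iN.
by apply: traverses_edge => //; [case: (he i iN) | exact: hJ].
Qed.

(** Serves the cases [m = 1] and [m = 4] with [n] even, where no tour exists at all, nullhomotopic
    or not. *)
Lemma tour_joining_jumps : exists J : nat -> jump,
  forall i, (i < m * n)%N ->
    [/\ is_jump m n (J i), E i = edge_of n (J i), (J i).2 = v i &
        jump_target n (J i) = v (i.+1 %% (m * n))%N].
Proof.
case: (vE) => _ _ _ he _; rewrite tour_lengthE in he.
have /choice[J hJ] : forall i, exists j, (i < m * n)%N ->
    traverses n (E i) (v i) (v (i.+1 %% (m * n))%N) j.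
  move=> i; case: (ltnP i (m * n)) => iN; last by exists ((0, 0), (0, 0)).
  by case: (he i iN) => _ [j hj]; exists j.
by exists J; apply: tour_jumps; rewrite tour_lengthE.
Qed.

(** The partial sums of the jumps are the corners of the lift that starts at [(0, 0)], and this lift
    is closed. *)
Lemma nullhomotopic_tour_jumps : tour_nullhomotopic R m n v E ->
  exists J : nat -> jump,
  [/\ forall i, (i < m * n)%N ->
    [/\ is_jump m n (J i), E i = edge_of n (J i), (J i).2 = v i &
        jump_target n (J i) = v (i.+1 %% (m * n))%N],
    \sum_(0 <= i < m * n) (J i).1.1 = 0 & \sum_(0 <= i < m * n) (J i).1.2 = 0].
Proof.
move=> [J [/tour_jumps hJ]]; rewrite tour_lengthE => hH.
pose L i := (\sum_(0 <= k < i) (J k).1.1, \sum_(0 <= k < i) (J k).1.2).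
have N0 : (0 < m * n)%N by apply: ltnW.
case: vE => v0 vv _ _ _.
(* The lift agrees with the tour in the column, and modulo [n] in the height. *)
have hL i : (i <= m * n)%N -> (L i).1 = (v (i %% (m * n))%N).1 /\
    exists k : int, (L i).2 = (v (i %% (m * n))%N).2 + k * n%:Z.
  elim: i => [_|i IH iN].
    by rewrite mod0n v0 /L !big_geq //; split => //; exists 0; rewrite mul0r.
  have [h1 [k h2]] := IH (ltnW iN); have [_ _ hs ht] := hJ i iN.
  rewrite modn_small // -hs in h1 h2.
  rewrite -ht /jump_target /= !big_nat_recr //=; split.
    by rewrite -h1.
  exists (k + divz ((J i).2.2 + (J i).1.2) n%:Z).
  move: h2 (divz_eq ((J i).2.2 + (J i).1.2) n%:Z); rewrite /= => -> h.
  set r := modz _ _ in h *; set q := divz _ _ in h *.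
  by rewrite addrAC h; ring.
have LN : L (m * n)%N = (0, 0).
  apply: (@jumps_nullhomotopic R m n n_gt0 J L (m * n) _ _ _).1 hH.
  - by rewrite /L !big_geq.
  - move=> i /hL[-> _].
    by have := vv _ (ltn_pmod i N0); rewrite /is_vertex => /andP[].
  - move=> i iN; have [h1 h2] := hL i (ltnW iN); have [_ _ hs _] := hJ i iN.
    rewrite modn_small // -hs in h1 h2; split => //.
    rewrite /L !big_nat_recr //= [X in (X - _, _)]addrC [X in (_, X - _)]addrC !addrK.
    by case: (J i) => [[]].
exists J; split => //; first by case: LN.
by case: LN.
Qed.

Lemma nullhomotopic_tour_not_odd : tour_nullhomotopic R m n v E -> ~~ (odd m && odd n).
Proof.
move=> /nullhomotopic_tour_jumps[J [hJ sx sy]].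
(* Each summand is even, while the whole sum is [- (m * n)] as the jumps add up to zero. *)
have : (2 %| \sum_(0 <= i < m * n) ((J i).1.1 + (J i).1.2 - 1))%Z.
  rewrite big_nat; elim/big_rec: _ => // i z /andP[_ iN] hz.
  apply: rpredD => //; have [/and3P[/knight_pairP hk _ _] _ _ _] := hJ i iN.
  by case: hk => [[[->|->] [->|->]]|[[->|->] [->|->]]].
rewrite sumrB big_split /= sx sy !add0r rpredN /=.
rewrite sumr_const_nat subn0 -mulr_natl natz mulr1 -oddM.
by lia.
Qed.

Lemma nullhomotopic_tour_neq2 : tour_nullhomotopic R m n v E -> m <> 2%N.
Proof.
move=> /nullhomotopic_tour_jumps[J [hJ _ sy]] m2.
(* Each jump switches columns, so it rises or falls by 2; a change of direction would go back along
   the same edge, but the edges are distinct. *)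
have cst_step i : (i.+1 < m * n)%N -> (J i.+1).1.2 = (J i).1.2.
  move=> iN; have iN' := ltnW iN.
  have [ji Ei si ti] := hJ i iN'; have [ji' Ei' si' _] := hJ _ iN.
  rewrite modn_small // in ti.
  case: (vE) => _ _ _ _; rewrite tour_lengthE => /(_ i i.+1 iN' iN) inj.
  have : J i.+1 <> jump_rev n (J i).
    move=> h; suff : i = i.+1 by lia.
    by apply: inj; rewrite Ei Ei' h (edge_of_rev n_gt0 ji).
  have : (J i.+1).2 = jump_target n (J i) by rewrite si' ti.
  move: (J i) (J i.+1) ji ji' => [[x y] [a b]] [[x' y'] [a' b']] /=.
  move=> /and3P[/knight_pairP /= hk /andP[/= ha _] hax].
  move=> /and3P[/knight_pairP /= hk' /andP[/= ha' _] hax'].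
  rewrite /jump_rev /jump_target /= => -[aE bE].
  rewrite aE bE in ha' hax' *.
  move=> ne; apply/eqP; apply/negPn/negP => /eqP hy; apply: ne.
  by congr ((_, _), _); rewrite ?m2 in ha hax ha' hax' *; lia.
have all_same i : (i < m * n)%N -> (J i).1.2 = (J 0%N).1.2.
  by elim: i => // i IH iN; rewrite cst_step // IH // ltnW.
have : (J 0%N).1.2 *+ (m * n) = 0.
  rewrite -[RHS]sy big_nat (eq_bigr (fun=> (J 0%N).1.2)).
    by rewrite -big_nat sumr_const_nat subn0.
  by move=> i /andP[_ /all_same].
move/eqP; rewrite mulrn_eq0 gtn_eqF ?(ltnW mn_gt1) //= => /eqP J0.
by have [/and3P[/knight_pairP + _ _] _ _ _] := hJ 0%N (ltnW mn_gt1); rewrite J0; lia.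
Qed.

Lemma tour_neq1 : m <> 1%N.
Proof.
move=> m1; have [J hJ] := tour_joining_jumps.
have [/and3P[/knight_pairP hk /andP[h1 _] h2] _ _ _] := hJ 0%N (ltnW mn_gt1).
by move: h1 h2; rewrite m1; lia.
Qed.

(** The vertices of a tour are a permutation of the grid, so they can be counted column by
    column. *)
Lemma tour_count (P : pred vertex) :
  count P [seq v i | i <- iota 0 (m * n)] =
  count P [seq (a%:Z, b%:Z) | a <- iota 0 m, b <- iota 0 n].
Proof.
case: (vE) => _ vv vu _ _.
apply/permP; apply: uniq_perm.
- rewrite map_inj_in_uniq ?iota_uniq // => i k; rewrite !mem_iota /= => iN kN vik.
  have [j [_ ju]] := vu _ (vv _ iN).
  by rewrite -(ju i) // -(ju k).
- rewrite allpairs_uniq ?iota_uniq // => -[a b] [a' b'] _ _ /= [-> ->] //.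
- move=> w; apply/mapP/allpairsP => [[i]|[[a b]] /= []].
    rewrite mem_iota => /= iN ->; have /andP[h1 h2] := vv _ iN.
    exists (`|(v i).1|%N, `|(v i).2|%N); rewrite /= !mem_iota.
    split; [lia|lia|].
    by case: (v i) h1 h2 => x y /=; move=> h1 h2; congr pair; lia.
  rewrite !mem_iota => ha hb ->.
  have [|i [[iN vi] _]] := vu (a%:Z, b%:Z); first by rewrite /is_vertex /=; lia.
  by exists i => //; rewrite mem_iota.
Qed.

Lemma tour_neq4_even : m = 4%N -> odd n.
Proof.
move=> m4; apply/negPn/negP => nev.
have [J hJ] := tour_joining_jumps; case: (vE) => v0 vv vu _ _.
have N0 : (0 < m * n)%N := ltnW mn_gt1.
pose outer (w : vertex) := (w.1 == 0) || (w.1 == 3).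
pose f i : nat := outer (v (i %% (m * n))%N).
(* No jump joins two vertices of columns 0 and 3: it would have to keep its column or cross three of
   them. *)
have f1 i : (i < m * n)%N -> (f i + f i.+1 <= 1)%N.
  move=> iN; have [ji _ si ti] := hJ i iN.
  rewrite /f (modn_small iN) -si -ti /outer /jump_target /=.
  move: ji => /and3P[/knight_pairP hk /andP[h1 _] h2].
  by rewrite m4 in h1 h2; lia.
have col i : (i < m * n)%N -> odd (absz ((v i).1 + (v i).2)) = odd i.
  elim: i => [_|i IH iN]; first by rewrite v0.
  have [ji _ si ti] := hJ i (ltnW iN); have := IH (ltnW iN).
  rewrite modn_small // in ti; rewrite -si -ti /jump_target /=.
  case/and3P: ji => hk _ _.
  by rewrite jump_parity // => ->.
have sf : (\sum_(0 <= i < m * n) f i = 2 * n)%N.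
  transitivity (count outer [seq v i | i <- iota 0 (m * n)]).
    rewrite count_map -sum1_count /index_iota subn0 [RHS]big_mkcond /=.
    rewrite big_seq [RHS]big_seq; apply: eq_bigr => i; rewrite mem_iota /= => iN.
    by rewrite /f modn_small //; case: outer.
  rewrite tour_count m4 /= !count_cat !count_map /= addn0.
  have c (a : int) : count (preim (fun b : nat => (a, b%:Z)) outer) (iota 0 n) =
      (((a == 0%R) || (a == 3%R)) * n)%N.
    rewrite /outer /preim /=; case: (_ || _).
      by rewrite (eq_count (a2 := predT)) // count_predT size_iota mul1n.
    by rewrite (eq_count (a2 := pred0)) // count_pred0.
  by rewrite !c /= !mul1n !mul0n !add0n addnn mul2n.
have sfS : (\sum_(0 <= i < m * n) f i.+1 = 2 * n)%N.
  rewrite -sf; apply/eqP; rewrite -(eqn_add2l (f 0%N)) -big_nat_recl // big_nat_recr //= addnC.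
  by rewrite /f modnn mod0n.
(* The slacks are nonnegative with total [4 * n - (2 * n + 2 * n) = 0], so outer and inner vertices
   alternate strictly. *)
have s1 : (\sum_(0 <= i < m * n) (1 - (f i + f i.+1)) = 0)%N.
  rewrite big_nat sumnB; last by move=> i /andP[_ /f1].
  by rewrite -!big_nat big_split /= sf sfS sum_nat_const_nat subn0 m4; lia.
have alt i : (i < m * n)%N -> f i = ~~ odd i.
  elim: i => [_|i IH iN]; first by rewrite /f mod0n v0.
  move/eqP: s1; rewrite big_mkord sum_nat_eq0 => /forallP /(_ (Ordinal (ltnW iN))) /=.
  have := f1 i (ltnW iN); rewrite (IH (ltnW iN)).
  by case: (f i.+1) (odd i) => [|[|k]] [].
(* As an outer vertex [(3, 0)] has an even position, but its colour requires an odd one. *)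
have [|i [[iN vi] _]] := vu (3, 0); first by rewrite /is_vertex m4 /=; lia.
by have := alt i iN; rewrite -col // /f modn_small // vi.
Qed.

End Necessity.

(** * From lifted tours to tours *)

Definition adj (p q : int * int) : bool := knight_pair (q.1 - p.1, q.2 - p.2).

(* The starting point (0, 0) is listed at the end of s, as the point to which the
   tour returns. *)
Definition lifted_tour (m n : nat) (s : seq (int * int)) : Prop :=
  [/\ path adj (0, 0) s, last (0, 0) s = (0, 0), size s = (m * n)%N,
      all (fun p => 0 <= p.1 < m%:Z) s
    & forall (a : nat) (b : int), (a < m)%N ->
        exists2 p, p \in s & p.1 = a%:Z /\ (n%:Z %| p.2 - b)%Z].

Section LiftedTour.
Context (R : realType) (m n : nat) (s : seq (int * int)).
Hypothesis (n_gt0 : (0 < n)%N) (mn_gt2 : (2 < m * n)%N) (ts : lifted_tour m n s).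

Let N := (m * n)%N.
Let p (i : nat) : int * int := nth (0, 0) ((0, 0) :: s) i.
Let v (i : nat) : vertex := ((p i).1, modz (p i).2 n%:Z).
Let J (i : nat) : jump := (((p i.+1).1 - (p i).1, (p i.+1).2 - (p i).2), v i).

Lemma lifted_point_column i : (i <= N)%N -> 0 <= (p i).1 <= m%:Z - 1.
Proof.
case: (ts) => _ _ ss /allP al _; case: i => [_|i iN].
  have : (0 < m)%N by move: mn_gt2; case: (m).
  by rewrite /p /=; lia.
have /al : p i.+1 \in s by rewrite /p /= mem_nth // ss.
by move=> /andP[-> h] /=; rewrite lerBrDr -ltzD1 ltrD2r.
Qed.

Lemma lifted_point_last : p N = (0, 0).
Proof.
case: (ts) => _ ls ss _ _.
by rewrite -[RHS]ls /p /N -ss (last_nth (0, 0)).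
Qed.

Lemma lifted_point_next i : (i < N)%N -> v (i.+1 %% N) = v i.+1.
Proof.
rewrite leq_eqVlt => /orP[/eqP iN|iN]; last by rewrite modn_small.
have e : p i.+1 = (0, 0) by rewrite iN lifted_point_last.
by rewrite /v e iN modnn.
Qed.

Lemma lifted_vertex i : (i <= N)%N -> is_vertex m n (v i).
Proof.
move=> iN; rewrite /is_vertex /v /= lifted_point_column // modz_ge0 ?gt_eqF //=.
by have := @ltz_pmod (p i).2 n%:Z n_gt0; lia.
Qed.

Lemma lifted_jump i : (i < N)%N ->
  is_jump m n (J i) /\ jump_target n (J i) = v i.+1.
Proof.
move=> iN; case: (ts) => /(pathP (0, 0)) pt _ ss _ _; split.
  apply/and3P; split; first by apply: pt; rewrite ss.
    exact: lifted_vertex (ltnW iN).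
  by rewrite /= addrC subrK lifted_point_column.
by rewrite /jump_target /= addrC subrK modzDml [_ + (_ - _)]addrC subrK.
Qed.

Lemma lifted_vertex_surj w : is_vertex m n w -> exists2 i, (i < N)%N & v i = w.
Proof.
case: (ts) => _ ls ss _ cov; case: w => a b /andP[/= ha hb].
have [|q qs [qa qb]] := cov (absz a) b; first by lia.
have [i iN pq] : exists2 i, (i < N)%N & p i = q.
  have : (index q s < N)%N by rewrite /N -ss index_mem.
  (* If [q] is the last point of [s], its index [N] is out of range, and 0 replaces it as
     [p N = p 0]. *)
  rewrite leq_eqVlt => /orP[/eqP iE|iN].
    exists 0%N; first by rewrite /N; lia.
    by rewrite -[RHS](nth_index (0, 0) qs) -[LHS]lifted_point_last -iE.
  by exists (index q s).+1 => //; rewrite /p /= nth_index.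
exists i => //; rewrite /v pq; congr pair.
  by rewrite qa gez0_abs; case/andP: ha.
have /eqP : (q.2 == b %[mod n%:Z])%Z by rewrite eqz_mod_dvd.
by move=> ->; rewrite modz_small //; lia.
Qed.

(** Pigeonhole: [v] maps [N] indices onto all [N] vertices. *)
Lemma lifted_vertex_inj i k : (i < N)%N -> (k < N)%N -> v i = v k -> i = k.
Proof.
move=> iN kN vik.
pose W := [seq (a%:Z, b%:Z) | a <- iota 0 m, b <- iota 0 n].
have uW : uniq W.
  by rewrite allpairs_uniq ?iota_uniq // => -[a b] [a' b'] _ _ /= [-> ->].
have WV : {subset W <= [seq v i | i <- iota 0 N]}.
  move=> w /allpairsP[[a b] /= []]; rewrite !mem_iota => ha hb ->.
  have [|l lN <-] := @lifted_vertex_surj (a%:Z, b%:Z).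
    by rewrite /is_vertex /=; lia.
  by apply: map_f; rewrite mem_iota.
have : uniq [seq v i | i <- iota 0 N].
  by apply: leq_size_uniq uW WV _; rewrite size_allpairs size_map !size_iota.
move=> /(uniqP (v 0%N)) /(_ i k); rewrite size_map size_iota => /(_ iN kN).
by rewrite !(nth_map 0%N) ?size_iota // !nth_iota //; apply.
Qed.

Lemma lifted_tour_supports : supports_nullhomotopic_tour R m n.
Proof.
have tl : tour_length m n = N by rewrite /tour_length gtn_eqF // ltnW.
have N0 : (0 < N)%N by rewrite /N; lia.
exists v, (fun i => edge_of n (J i)); split; last first.
  exists J; rewrite tl; split.
    move=> i iN; have [_ ti] := lifted_jump iN.
    by split; [left | | rewrite lifted_point_next].
  apply/(@jumps_nullhomotopic R m n n_gt0 J p N); last exact: lifted_point_last.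
  - by [].
  - exact: lifted_point_column.
  - move=> i iN; split => //; exists (divz (p i).2 n%:Z).
    by rewrite /= addrC -divz_eq.
split.
- by rewrite /v /p /= mod0z.
- by move=> i /ltnW; exact: lifted_vertex.
- move=> w /lifted_vertex_surj[i iN vi]; exists i; split => // k [kN vk].
  by apply: lifted_vertex_inj => //; rewrite vi vk.
- move=> i; rewrite tl => iN; have [ji ti] := lifted_jump iN; split.
    by exists (J i).
  by exists (J i); split; [left | | rewrite lifted_point_next].
- move=> i k; rewrite tl => iN kN Eik.
  have : edge_of n (J k) (J i) by rewrite -Eik; left.
  case=> [Jik|Jik].
    by apply: lifted_vertex_inj => //; have := congr1 snd Jik.
  (* If [J i] is the reverse of [J k], then [i] and [k] are cyclic successors of each other, so [N]
     divides 2, against [mn_gt2]. *)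
  have [_ ti] := lifted_jump iN; have [_ tk] := lifted_jump kN.
  have vi : v i = v k.+1 by rewrite -tk; have := congr1 snd Jik.
  have vk : v i.+1 = v k.
    rewrite -ti Jik; have [jk _] := lifted_jump kN.
    by have := congr1 snd (jump_revK n_gt0 jk).
  rewrite -lifted_point_next // in vi; rewrite -lifted_point_next // in vk.
  have := lifted_vertex_inj iN (ltn_pmod _ N0) vi.
  have := lifted_vertex_inj (ltn_pmod _ N0) kN vk.
  have modS l : (l < N)%N -> (l.+1 %% N = if l.+1 == N then 0 else l.+1)%N.
    move=> lN; case: eqP => [->|ne]; first by rewrite modnn.
    by rewrite modn_small // ltn_neqAle lN andbT; apply/eqP.
  rewrite !modS //; have : (2 < N)%N by [].
  case: eqP; case: eqP; lia.
Qed.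

End LiftedTour.

(** * Widening a tour *)

Definition rung (c : nat) (p q : int * int) : bool :=
  (p.1 == c%:Z) && (q == (p.1 + 1, p.2 + 2)).

(* Heights in column c of the rungs traversed, in either direction. *)
Fixpoint rungs (c : nat) (p : int * int) (s : seq (int * int)) : seq int :=
  if s is q :: s' then
    (if rung c p q then [:: p.2] else if rung c q p then [:: q.2] else [::]) ++
    rungs c q s'
  else [::].

(** As the [n] heights meet every residue modulo [n], each rung between the last two columns is
    traversed exactly once. *)
Definition railed (m n : nat) (s : seq (int * int)) : Prop :=
  size (rungs m.-2 (0, 0) s) = n /\
  forall b : int, exists2 b', b' \in rungs m.-2 (0, 0) s & (n%:Z %| b' - b)%Z.

(** A knight move that carries the last two columns onto the two new ones, and rungs to rungs. *)
Definition shift21 (p : int * int) : int * int := (p.1 + 2, p.2 + 1).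

Fixpoint widen (c : nat) (p : int * int) (s : seq (int * int)) : seq (int * int) :=
  if s is q :: s' then
    (if rung c p q || rung c q p then [:: shift21 p; shift21 q] else [::]) ++
    q :: widen c q s'
  else [::].

Lemma adj_shift21 p q : adj (shift21 p) (shift21 q) = adj p q.
Proof. by rewrite /adj /shift21 /=; congr (knight_pair (_, _)); ring. Qed.

Lemma adj_to_shift21 p : adj p (shift21 p).
Proof. by rewrite /adj /shift21 /= !(addrAC _ _ (- _)) !subrr. Qed.

Lemma adj_sym p q : adj p q = adj q p.
Proof. by rewrite /adj /knight_pair /= !(distrC q.1) !(distrC q.2). Qed.

Lemma rungsP c p q : rung c p q ->
  [/\ p.1 = c%:Z, q.1 = c.+1%:Z & q.2 = p.2 + 2].
Proof. by case/andP => /eqP pc /eqP ->; rewrite /= pc; split => //; lia. Qed.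

Lemma path_widen c p s : path adj p s -> path adj p (widen c p s).
Proof.
elim: s p => //= q s IH p /andP[pq /IH h]; case: ifP => _ /=; last by rewrite pq.
by rewrite adj_to_shift21 adj_shift21 pq adj_sym adj_to_shift21.
Qed.

Lemma last_widen c p s : last p (widen c p s) = last p s.
Proof. by elim: s p => //= q s IH p; rewrite last_cat /= IH. Qed.

Lemma size_widen c p s : size (widen c p s) = (size s + 2 * size (rungs c p s))%N.
Proof.
elim: s p => //= q s IH p; rewrite !size_cat /= IH.
by case: (boolP (rung c p q)) => [h|h]; [|case: (boolP (rung c q p)) => h'];
  rewrite ?h ?h' /=; lia.
Qed.

Lemma widen_sub c p s : {subset s <= widen c p s}.
Proof.
elim: s p => //= q s IH p r; rewrite inE mem_cat inE.
by move=> /orP[->|/IH ->]; rewrite !orbT.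
Qed.

(** The ends [(c, b)] and [(c + 1, b + 2)] of the rung are shifted by [(2, 1)], whichever way it is
    traversed. *)
Lemma mem_widen_rungs c p s b : b \in rungs c p s ->
  ((c.+2%:Z, b + 1) \in widen c p s) /\ ((c.+3%:Z, b + 3) \in widen c p s).
Proof.
elim: s p => //= q s IH p; rewrite mem_cat => /orP[|/IH[h1 h2]]; last first.
  by rewrite !mem_cat !inE h1 h2 !orbT.
have e3 (x : int) : x + 2 + 1 = x + 3 by ring.
case: (boolP (rung c p q)) => [/rungsP[h1 h2 h3]|_].
  rewrite inE => /eqP ->; rewrite /shift21 h1 h2 h3 e3 !mem_cat !inE.
  have -> : c%:Z + 2 = c.+2 by lia.
  have -> : c.+1%:Z + 2 = c.+3 by lia.
  by rewrite !eqxx !orbT.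
case: (boolP (rung c q p)) => [/rungsP[h1 h2 h3]|//].
rewrite inE => /eqP ->; rewrite /shift21 h1 h2 h3 e3 !mem_cat !inE.
have -> : c%:Z + 2 = c.+2 by lia.
have -> : c.+1%:Z + 2 = c.+3 by lia.
by rewrite !eqxx !orbT.
Qed.

Lemma all_widen c p s : all (fun q => 0 <= q.1 < c.+2%:Z) s ->
  all (fun q => 0 <= q.1 < c.+4%:Z) (widen c p s).
Proof.
elim: s p => //= q s IH p /andP[hq /IH h]; rewrite all_cat /= h andbT.
have hq' : 0 <= q.1 < c.+4%:Z by lia.
rewrite hq' andbT; case: ifP => //= /orP[] /rungsP[h1 h2 _];
  by rewrite /shift21 /= h1 h2; lia.
Qed.

(** The old points lie left of column [c.+2], so only the middle edge of a detour can be a new rung,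
    and it is one. *)
Lemma rungs_widen c p s : p.1 < c.+2%:Z ->
  all (fun q => 0 <= q.1 < c.+2%:Z) s ->
  rungs c.+2 p (widen c p s) = [seq b + 1 | b <- rungs c p s].
Proof.
have Nr u w : u.1 < c.+2%:Z -> rung c.+2 u w = false.
  by move=> h; rewrite /rung lt_eqF.
have shr u w : rung c.+2 (shift21 u) (shift21 w) = rung c u w.
  have ec (x y : int) : (x + 2 == y + 2) = (x == y) by rewrite (inj_eq (addIr _)).
  rewrite /rung /shift21 /= -!pair_eqE /pair_eq /=; congr andb; first by lia.
  by congr andb; lia.
have Nr' u w : u.1 < c.+2%:Z -> rung c.+2 (shift21 w) u = false.
  move=> h; rewrite /rung /shift21 /= -pair_eqE /pair_eq /=; apply/negbTE/negP.
  by move=> /andP[/eqP e /andP[/eqP e' _]]; move: h; rewrite e' e; lia.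
elim: s p => //= q s IH p pc /andP[/andP[q0 qc] /IH h].
rewrite map_cat -(h _ qc).
case: (boolP (rung c p q)) => [r|r] /=.
  rewrite !(Nr _ _ pc) (Nr' _ _ pc) (Nr' _ _ qc) (Nr _ _ qc) shr r //=.
case: (boolP (rung c q p)) => [r'|r'] /=.
  by rewrite !(Nr _ _ pc) (Nr' _ _ pc) (Nr' _ _ qc) (Nr _ _ qc) !shr (negbTE r) r' //=.
by rewrite !(Nr _ _ pc) !(Nr _ _ qc).
Qed.

Lemma widen_lifted_tour (m n : nat) s : (1 < m)%N ->
  lifted_tour m n s -> railed m n s ->
  lifted_tour m.+2 n (widen m.-2 (0, 0) s) /\ railed m.+2 n (widen m.-2 (0, 0) s).
Proof.
case: m => [|[|c]] // _ [ps ls ss als cov] [sr covr] /=.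
have r2 : rungs c.+2 (0, 0) (widen c (0, 0) s) = [seq b + 1 | b <- rungs c (0, 0) s].
  by apply: rungs_widen => //=.
split; split.
- exact: path_widen.
- by rewrite last_widen.
- by rewrite size_widen ss sr; lia.
- exact: all_widen.
- move=> a b; rewrite ltnS leq_eqVlt => /orP[/eqP->|];
    last rewrite ltnS leq_eqVlt => /orP[/eqP->|].
  (* The shifted rungs cover both new columns: their ends lie 3 and 1 above the height of the old
     rung. *)
  + have [b' /mem_widen_rungs[_ h] hb] := covr (b - 3).
    exists (c.+3%:Z, b' + 3) => //=; split => //.
    by rewrite (_ : _ - _ = b' - (b - 3)) //; ring.
  + have [b' /mem_widen_rungs[h _] hb] := covr (b - 1).
    exists (c.+2%:Z, b' + 1) => //=; split => //.
    by rewrite (_ : _ - _ = b' - (b - 1)) //; ring.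
  + by move=> /(cov a b)[q /widen_sub qs hq]; exists q.
- by rewrite /= r2 size_map.
- move=> b; have [b' hb' hd] := covr (b - 1); exists (b' + 1).
    by rewrite /= r2; exact: (map_f (fun b : int => b + 1)).
  by rewrite (_ : _ - _ = b' - (b - 1)) //; ring.
Qed.

Lemma widen_lifted_tours (m n : nat) : (1 < m)%N ->
  (exists2 s, lifted_tour m n s & railed m n s) ->
  forall k, exists2 s, lifted_tour (m + k.*2) n s & railed (m + k.*2) n s.
Proof.
move=> m1 hs; elim=> [|k [s ts rs]]; first by rewrite addn0.
have [|h1 h2] := widen_lifted_tour _ ts rs; first by lia.
by rewrite doubleS !addnS; exists (widen (m + k.*2).-2 (0, 0) s).
Qed.

(** * Tours of widths 3, 4 and 6 *)

Definition shift2 (d : int) (p : int * int) : int * int := (p.1, p.2 + d).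

Lemma adj_shift2 d p q : adj (shift2 d p) (shift2 d q) = adj p q.
Proof. by rewrite /adj /shift2 /=; congr (knight_pair (_, _)); ring. Qed.

Lemma path_shift2 d p s : path adj (shift2 d p) (map (shift2 d) s) = path adj p s.
Proof. by elim: s p => //= q s IH p; rewrite adj_shift2 IH. Qed.

Lemma rung_shift2 c d p q : rung c (shift2 d p) (shift2 d q) = rung c p q.
Proof.
rewrite /rung /shift2 /= -!pair_eqE /pair_eq /=.
by rewrite addrAC (inj_eq (addIr d)).
Qed.

Lemma rungs_shift2 c d p s :
  rungs c (shift2 d p) (map (shift2 d) s) = [seq b + d | b <- rungs c p s].
Proof.
elim: s p => //= q s IH p; rewrite IH !rung_shift2 map_cat; congr cat.
by do 2?case: ifP.
Qed.

Lemma rungs_cat c p s t : rungs c p (s ++ t) = rungs c p s ++ rungs c (last p s) t.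
Proof. by elim: s p => //= q s IH p; rewrite IH catA. Qed.

(** Bezout gives an inverse [u] of [st] modulo [n], and [i] is [(b - a) * u] reduced modulo [n]. *)
Lemma arith_progression_residue (n st : nat) (a b : int) :
  (0 < n)%N -> coprime st n -> exists2 i : nat, (i < n)%N & (n%:Z %| a + (st * i)%:Z - b)%Z.
Proof.
move=> n0 cn; have /coprimezP[[u w] /= uw] : coprimez st%:Z n%:Z by [].
pose i := modz ((b - a) * u) n%:Z.
have i0 : 0 <= i by apply: modz_ge0; rewrite gt_eqF.
have iE : (absz i)%:Z = i by rewrite gez0_abs.
exists (absz i); first by rewrite -ltz_nat iE; exact: ltz_pmod.
rewrite PoszM iE /i.
have := divz_eq ((b - a) * u) n%:Z; set r := modz _ _; set d := divz _ _ => h.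
have rE : r = (b - a) * u - d * n%:Z by rewrite h; ring.
apply/dvdzP; exists (- (b - a) * w - d * st%:Z).
have -> : a + st%:Z * r - b = (b - a) * (u * st%:Z - 1) - d * st%:Z * n%:Z.
  by rewrite rE; ring.
by rewrite (_ : u * st%:Z = 1 - w * n%:Z); [ring | rewrite -uw; ring].
Qed.

Lemma addn_swap4 (u x y z : nat) : (u + x + (y + z) = x + y + (u + z))%N.
Proof. lia. Qed.

Lemma addn_swap5 (a u z b : nat) : (a + (u + (z + b).+1) = a + b.+1 + (u + z))%N.
Proof. lia. Qed.

(** * Enlarging the circumference of a tour *)

Section Family.
Context (m st n0 k : nat) (f : seq int) (A B X Y : seq (int * int)) (q : int * int).

Let p := last (0, 0) A.
Let T : int := (st * k)%:Z.

(* For circumference n = n0 + k j the lift visits, in column a, the points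
   f_a, f_a + st, ..., f_a + st (n - 1), which meet each residue modulo n once as
   st is coprime to n. It climbs from p to p + (0, T j) by translates of X, jumps
   to q + (0, T j), and comes down to q by translates of Y. *)
Definition family_base : bool :=
  let s := A ++ q :: B in
  [&& path adj (0, 0) s, last q B == (0, 0), size s == (m * n0)%N,
      all (fun r => 0 <= r.1 < m%:Z) s
    & all (fun a => all (fun i => (a%:Z, f`_a + (st * i)%:Z) \in s) (iota 0 n0))
        (iota 0 m)] &&
  [&& ~~ rung m.-2 p q, ~~ rung m.-2 q p, size (rungs m.-2 (0, 0) s) == n0
    & all (fun i => f`_m.-2 + (st * i)%:Z \in rungs m.-2 (0, 0) s) (iota 0 n0)].

(** [T] is the length of [k] steps of the progression. The turning point [q] moves up to
    [shift2 T q], so [Y] has to visit [q] itself; together with the new turning point, [X] and [Y]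
    supply the next [k] terms in every column. *)
Definition family_step : bool :=
  let s := X ++ Y in let r := rungs m.-2 p X ++ rungs m.-2 (shift2 T q) Y in
  [&& path adj p X, last p X == shift2 T p, path adj (shift2 T q) Y,
      last (shift2 T q) Y == q, q \in Y & size s == (m * k)%N] &&
  [&& all (fun r => 0 <= r.1 < m%:Z) s,
      all (fun a => all (fun i => (a%:Z, f`_a + (st * (n0 + i))%:Z) \in shift2 T q :: s)
        (iota 0 k)) (iota 0 m),
      size r == k & all (fun i => f`_m.-2 + (st * (n0 + i))%:Z \in r) (iota 0 k)].

Fixpoint ascent (j : nat) : seq (int * int) :=
  if j is j'.+1 then ascent j' ++ map (shift2 (T * j'%:Z)) X else [::].

Fixpoint descent (j : nat) : seq (int * int) :=
  if j is j'.+1 then map (shift2 (T * j'%:Z)) Y ++ descent j' else [::].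

Definition family_tour (j : nat) : seq (int * int) :=
  A ++ ascent j ++ shift2 (T * j%:Z) q :: descent j ++ B.

Lemma shift2D d e r : shift2 d (shift2 e r) = shift2 (e + d) r.
Proof. by rewrite /shift2 /= addrA. Qed.

Lemma shift20 r : shift2 0 r = r.
Proof. by case: r => a b; rewrite /shift2 /= addr0. Qed.

Lemma TS j : T * j.+1%:Z = T + T * j%:Z.
Proof. by rewrite -[j.+1]addn1 PoszD mulrDr mulr1 addrC. Qed.

(** By induction on [j], each new pair of translates of [X] and [Y] adds the next [k] terms in every
    column and the next [k] rungs. For [j = 0] nothing is asked of [X] and [Y]. *)
Lemma family_invariant j : family_base -> ((0 < j)%N -> family_step) ->
  [/\ path adj p (ascent j), last p (ascent j) = shift2 (T * j%:Z) p,
      path adj (shift2 (T * j%:Z) q) (descent j),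
      last (shift2 (T * j%:Z) q) (descent j) = q
    & size (ascent j ++ descent j) = (m * (k * j))%N] /\
  [/\ all (fun r => 0 <= r.1 < m%:Z) (ascent j ++ descent j),
      forall a i, (a < m)%N -> (i < n0 + k * j)%N ->
        (a%:Z, f`_a + (st * i)%:Z) \in family_tour j,
      size (rungs m.-2 p (ascent j) ++
            rungs m.-2 (shift2 (T * j%:Z) q) (descent j)) = (k * j)%N
    & forall i, (i < n0 + k * j)%N ->
        f`_m.-2 + (st * i)%:Z \in rungs m.-2 (0, 0) (A ++ q :: B) ++
          rungs m.-2 p (ascent j) ++ rungs m.-2 (shift2 (T * j%:Z) q) (descent j)].
Proof.
move=> /andP[/and5P[pb lb sb ab cb] /and4P[r1 r2 sr cr]].
elim: j => [_|j IH hs].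
  rewrite /family_tour mulr0 /= !shift20 !muln0 addn0 cats0.
  split; split=> //; last by move=> i iN; apply: (allP cr); rewrite mem_iota.
  move=> a i am iN; have am' : a \in iota 0 m by rewrite mem_iota.
  by have /allP h := allP cb _ am'; apply: h; rewrite mem_iota.
have /andP[/and5P[pX lX pY lY /andP[qY sXY]] /and4P[aXY cXY rXY crXY]] := hs isT.
have [[pU lU pV lV sUV] [aUV cUV rUV crUV]] := IH (fun _ => hs isT).
have lX' : last (shift2 (T * j%:Z) p) (map (shift2 (T * j%:Z)) X) =
    shift2 (T * j.+1%:Z) p.
  by rewrite last_map (eqP lX) shift2D TS.
have qj : shift2 (T * j.+1%:Z) q = shift2 (T * j%:Z) (shift2 T q) by rewrite shift2D TS.
have lY' : last (shift2 (T * j.+1%:Z) q) (map (shift2 (T * j%:Z)) Y) =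
    shift2 (T * j%:Z) q.
  by rewrite qj last_map (eqP lY).
have ash s : all (fun r => 0 <= r.1 < m%:Z) (map (shift2 (T * j%:Z)) s) =
    all (fun r => 0 <= r.1 < m%:Z) s.
  by rewrite all_map; apply: eq_all.
have i_split i : (i < n0 + k * j.+1)%N -> (i < n0 + k * j)%N \/
    exists2 i', (i' < k)%N & i = (n0 + i' + k * j)%N.
  move=> h; case: (ltnP i (n0 + k * j)) => h'; first by left.
  right; exists (i - (n0 + k * j))%N; last by rewrite addnAC subnKC.
  by rewrite ltn_subLR // -addnA [(_ + k)%N]addnC -mulnS.
(* A new term is the translate by [T * j] of one supplied by the untranslated patterns. *)
have addT (x : int) i' :
    x + (st * (n0 + i' + k * j))%:Z = x + (st * (n0 + i'))%:Z + T * j%:Z.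
  by rewrite /T mulnDr !PoszD mulnA PoszM addrA.
split; split => /=.
- by rewrite cat_path pU lU path_shift2.
- by rewrite last_cat lU lX'.
- by rewrite cat_path {1}qj path_shift2 pY lY'.
- by rewrite last_cat lY'.
- move: sUV sXY; rewrite !size_cat !size_map => h1 /eqP h2.
  by rewrite mulnS mulnDr -h1 -h2 addn_swap4.
- by move: aUV aXY; rewrite !all_cat !ash => /andP[-> ->] /andP[-> ->].
- move=> a i am /i_split[iN|[i' ik ->]].
    have := cUV a i am iN.
    rewrite /family_tour /= !(mem_cat, inE).
    case/or4P => [->|->|/eqP->|/orP[->|->]]; rewrite ?orbT //.
    (* The former turning point is now visited by the top translate of [Y]. *)
    by rewrite (map_f (shift2 (T * j%:Z)) qY) !orbT.
  have am' : a \in iota 0 m by rewrite mem_iota.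
  have ik' : i' \in iota 0 k by rewrite mem_iota.
  have /allP /(_ _ ik') := allP cXY _ am'.
  move=> /(map_f (shift2 (T * j%:Z))); rewrite /= -qj map_cat {1}/shift2 /= -addT.
  rewrite /family_tour /= !(mem_cat, inE).
  by case/or3P => ->; rewrite ?orbT.
- rewrite !rungs_cat lU lY' {1}qj !rungs_shift2.
  move: rUV (eqP rXY); rewrite !size_cat !size_map => h1 h2.
  by rewrite mulnS -h1 addn_swap4 h2.
- move=> i; rewrite (rungs_cat _ p) (rungs_cat _ (shift2 _ q)) lU lY' {1}qj.
  rewrite !rungs_shift2 => /i_split[iN|[i' ik ->]].
    have := crUV i iN; rewrite !mem_cat.
    by case/or3P => ->; rewrite ?orbT.
  have ik' : i' \in iota 0 k by rewrite mem_iota.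
  have := allP crXY _ ik'.
  move=> /(map_f (fun b : int => b + T * j%:Z)); rewrite map_cat -addT !mem_cat.
  by case/orP => ->; rewrite ?orbT.
Qed.

Lemma family_lifted_tour j : family_base -> ((0 < j)%N -> family_step) ->
  (1 < m)%N -> (0 < n0)%N -> coprime st (n0 + k * j) ->
  lifted_tour m (n0 + k * j) (family_tour j) /\ railed m (n0 + k * j) (family_tour j).
Proof.
move=> hb hs m1 n00 cn.
have [[pU lU pV lV sUV] [aUV cUV rUV crUV]] := family_invariant hb hs.
have {hb} /andP[/and5P[pb lb sb ab cb] /and4P[r1 r2 sr cr]] := hb.
have n1 : (0 < n0 + k * j)%N by rewrite addn_gt0 n00.
move: pb; rewrite cat_path /= => /and3P[pA pq pB].
(* The patterns are inserted at the edge from [p] to [q]. Neither this edge nor its translate at the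
   top is a rung, so the rungs are only reordered. *)
have rE c : ~~ rung c p q -> ~~ rung c q p -> perm_eq (rungs c (0, 0) (family_tour j))
    (rungs c (0, 0) (A ++ q :: B) ++
     rungs c p (ascent j) ++ rungs c (shift2 (T * j%:Z) q) (descent j)).
  move=> n1' n2'; rewrite /family_tour !rungs_cat /= lU rungs_cat lV.
  rewrite -/p !rung_shift2 (negbTE n1') (negbTE n2') /=.
  by rewrite -!catA perm_cat2l catA perm_catC.
split; split.
- by rewrite /family_tour !cat_path /= -/p pA pU lU adj_shift2 pq cat_path pV lV pB.
- by rewrite /family_tour !last_cat /= last_cat lV (eqP lb).
- move: sUV (eqP sb); rewrite /family_tour !size_cat /= !size_cat => h1 h2.
  by rewrite mulnDr -h1 -h2 addn_swap5.
- move: ab aUV; rewrite /family_tour !all_cat /= !all_cat.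
  by move=> /and3P[-> -> ->] /andP[-> ->].
- move=> a b am.
  have [i iN hi] := arith_progression_residue f`_a b n1 cn.
  by exists (a%:Z, f`_a + (st * i)%:Z); [exact: cUV | split].
- rewrite (perm_size (rE _ r1 r2)) size_cat rUV.
  by rewrite (eqP sr).
- move=> b; have [i iN hi] := arith_progression_residue f`_m.-2 b n1 cn.
  exists (f`_m.-2 + (st * i)%:Z) => //.
  by rewrite (perm_mem (rE _ r1 r2)); exact: crUV.
Qed.

End Family.

(** * Explicit families and the classification *)

Definition railed_tour_exists (m n : nat) : Prop :=
  exists2 s, lifted_tour m n s & railed m n s.

Lemma family_railed_tour (m st n0 k : nat) (f : seq int)
    (A B X Y : seq (int * int)) (q : int * int) (j : nat) :
  family_base m st n0 f A B q ->
  ((0 < j)%N -> family_step m st n0 k f A X Y q) ->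
  (1 < m)%N -> (0 < n0)%N -> coprime st (n0 + k * j) ->
  railed_tour_exists m (n0 + k * j).
Proof.
move=> hb hs m1 n00 cn; have [h1 h2] := family_lifted_tour hb hs m1 n00 cn.
by exists (family_tour st k A B X Y q j).
Qed.

(* The numerical data in the next three lemmas were found by a computer search. *)
Lemma railed_tour_3_even (n : nat) : (0 < n)%N -> ~~ odd n -> railed_tour_exists 3 n.
Proof.
move=> n0 nev.
(* The patterns add 4 to [n], so the even [n] form two families, with [n = 2] apart. *)
have [->|[[j ->]|[j ->]]] : n = 2%N \/ (exists j, n = (4 + 4 * j)%N) \/
    (exists j, n = (6 + 4 * j)%N).
- have [n2|n2] := eqVneq n 2%N; first by left.
  have [h|h] := boolP (4 %| n)%N; right;
    [left; exists (n %/ 4).-1 | right; exists (n %/ 4).-1]; lia.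
(* Only [j = 0] occurs here, so the patterns are left empty. *)
- apply: (@family_railed_tour 3 1 2 4 [:: 0; -2; 0] [:: (1, -2); (2, 0)]
    [:: (1, -1); (2, 1); (0, 0)] [::] [::] (0, 1) 0) => //.
- apply: (@family_railed_tour 3 1 4 4 [:: 0; -1; 1]
    [:: (1, 2); (2, 4); (0, 3); (1, 1); (2, 3)]
    [:: (1, 0); (2, 2); (0, 1); (1, -1); (2, 1); (0, 0)]
    [:: (0, 4); (1, 6); (2, 8); (0, 7); (1, 5); (2, 7)]
    [:: (2, 5); (1, 3); (0, 5); (2, 6); (1, 4); (0, 2)] (0, 2)) => //.
  by rewrite coprime1n.
- apply: (@family_railed_tour 3 1 6 4 [:: 0; -1; 1]
    [:: (2, 1); (1, -1); (0, 1); (2, 2); (1, 0); (0, 2); (1, 4); (2, 6); (0, 5); (1, 3); (2, 5)]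
    [:: (2, 3); (1, 1); (0, 3); (2, 4); (1, 2); (0, 0)]
    [:: (0, 6); (1, 8); (2, 10); (0, 9); (1, 7); (2, 9)]
    [:: (2, 7); (1, 5); (0, 7); (2, 8); (1, 6); (0, 4)] (0, 4)) => //.
  by rewrite coprime1n.
Qed.

Lemma railed_tour_4_odd (n : nat) : odd n -> railed_tour_exists 4 n.
Proof.
move=> nodd; have [->|[j ->]] : n = 1%N \/ exists j, n = (3 + 2 * j)%N.
- have [n1|n1] := eqVneq n 1%N; first by left.
  by right; exists (n.-2)./2; lia.
- apply: (@family_railed_tour 4 2 1 2 [:: 0; 2; 1; 3] [::]
    [:: (3, 3); (1, 2); (0, 0)] [::] [::] (2, 1) 0) => //.
(* The progressions have step 2, which is coprime to the odd [n]. *)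
- apply: (@family_railed_tour 4 2 3 2 [:: 0; 0; -1; 1]
    [:: (2, -1); (3, 1); (1, 0); (0, 2); (2, 1); (3, 3); (1, 4)]
    [:: (2, 3); (0, 4); (1, 2); (0, 0)]
    [:: (0, 6); (2, 5); (3, 7); (1, 8)]
    [:: (2, 7); (0, 8); (1, 6); (3, 5)] (3, 5)) => //.
  by rewrite coprime2n; lia.
Qed.

Lemma railed_tour_6_even (n : nat) : (0 < n)%N -> ~~ odd n -> railed_tour_exists 6 n.
Proof.
move=> n0 nev; have [j ->] : exists j, n = (2 + 2 * j)%N by exists (n./2).-1; lia.
apply: (@family_railed_tour 6 1 2 2 [:: 0; 2; 1; 1; 0; 2] [:: (2, 1)]
  [:: (0, 1); (2, 2); (4, 1); (5, 3); (3, 2); (4, 0); (5, 2); (3, 1); (1, 2); (0, 0)]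
  [:: (0, 2); (1, 4); (3, 3); (5, 4); (4, 2); (2, 3)]
  [:: (0, 3); (2, 4); (4, 3); (5, 5); (3, 4); (1, 3)] (1, 3)) => //.
  by rewrite coprime1n.
Qed.

(** Widening by 2 keeps the parity of [m]. For odd [n] the width is even and starts from 4; for even
    [n] odd widths start from 3 and even ones from 6, as 4 is excluded. *)
Lemma railed_tour_all (m n : nat) : (2 < m)%N -> (0 < n)%N ->
  ~~ (odd m && odd n) -> ~ (m = 4%N /\ ~~ odd n) -> railed_tour_exists m n.
Proof.
move=> m2 n0 nodd n4.
have ext m0 k : m = (m0 + k.*2)%N -> (1 < m0)%N -> railed_tour_exists m0 n ->
    railed_tour_exists m n.
  by move=> -> m1 h; exact: widen_lifted_tours.
have [nodd'|nev] := boolP (odd n).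
  apply: (ext 4%N (m - 4)./2) => //; [lia|exact: railed_tour_4_odd].
have [modd|mev] := boolP (odd m).
  by apply: (ext 3%N (m - 3)./2) => //; [lia | exact: railed_tour_3_even].
apply: (ext 6%N (m - 6)./2) => //; [|exact: railed_tour_6_even].
suff : m <> 4%N by lia.
by move=> m4; apply: n4.
Qed.

Lemma constant_tour_supports (R : realType) : supports_nullhomotopic_tour R 1 1.
Proof.
have tl : tour_length 1 1 = 0%N by [].
exists (fun=> (0, 0)), (fun=> set0); split.
  split => //.
  move=> [a b] /andP[/= ha hb]; exists 0%N; split => [|[|i] []] //.
  by split => //; congr pair; lia.
exists (fun=> ((0, 0), (0, 0))); split => //.
apply/(@jumps_nullhomotopic R 1 1 isT _ (fun=> (0, 0)) 0) => //.
Qed.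

Theorem theorem4p1 (R : realType) (m n : nat) (m_ge1 : (1 <= m)%N)
    (n_ge1 : (1 <= n)%N) :
  supports_nullhomotopic_tour R m n <->
  ~ [\/ [/\ odd m, odd n & (1 < m)%N \/ (1 < n)%N],
        m = 1%N /\ (1 < n)%N,
        m = 2%N
      | m = 4%N /\ ~~ odd n].
Proof.
split.
  move=> [v [E [tE nE]]] H.
  have mn1 : (1 < m * n)%N.
    have : (1 < m)%N \/ (1 < n)%N.
      by case: H => [[_ _ h]|[_ h]|->|[-> _]]; [|right|left|left].
    by case=> h; [exact: (leq_mul h n_ge1) | exact: (leq_mul m_ge1 h)].
  case: H => [[mo no _]|[m1 _]|m2|[m4 nev]].
  - by have := nullhomotopic_tour_not_odd n_ge1 mn1 tE nE; rewrite mo no.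
  - exact: (tour_neq1 n_ge1 mn1 tE).
  - exact: (nullhomotopic_tour_neq2 n_ge1 mn1 tE nE).
  - by have := tour_neq4_even n_ge1 mn1 tE m4; rewrite (negbTE nev).
move=> H.
(* For [m <= 2] the excluded cases leave only [m = n = 1], with the constant loop. *)
have [m2|m2] := ltnP 2 m.
  have [s ts _] : railed_tour_exists m n.
    apply: railed_tour_all => //.
      by apply/negP => /andP[mo no]; apply: H; apply: Or41; split => //; left; lia.
    by move=> h; apply: H; apply: Or44.
  by apply: lifted_tour_supports ts; lia.
have m1 : m = 1%N.
  have : m <> 2%N by move=> h; apply: H; apply: Or43.
  by lia.
have n1 : n = 1%N.
  have : ~ (1 < n)%N by move=> h; apply: H; apply: Or42.
  by lia.
by rewrite m1 n1; exact: constant_tour_supports.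
Qed.
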